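(* Let $\phi$ be an admissible potential with equilibrium state $\mu_\phi$, and let $C>0$ be a constant for which the Gaussian concentration bound holds for $\mu_\phi$. Then for all $u>0$ and all $n\ge1$, $$\mu_\phi\Big(x:\ \Big|d_K(\mathscr{E}_n(x),\mu_\phi)-\int d_K(\mathscr{E}_n(y),\mu_\phi)\,d\mu_\phi(y)\Big|\ge u\Big)\le 2\,e^{-c\,nu^2},\qquad c=\frac{1}{4C}.$$
   Context: $A$ is a finite alphabet, $\mathbb{N}=\{0,1,2,\dots\}$, $\Omega=A^{\mathbb{N}}$ with points $x=x^0x^1x^2\cdots$, and $T:\Omega\to\Omega$ is the shift $(Tx)^k=x^{k+1}$. Fix $\theta\in(0,1)$ and put $d_\theta(x,y)=\theta^{\inf\{k:\,x^k\ne y^k\}}$ (with $d_\theta(x,x)=0$). For $\phi:\Omega\to\mathbb{R}$ write $S_n\phi=\sum_{i=0}^{n-1}\phi\circ T^i$. For $x,y\in\Omega$ let $W(\phi,x,y)=\sup_{n\in\mathbb{N}}\sup_{a\in A^n}|S_n\phi(ax)-S_n\phi(ay)|$, and for $p\in\mathbb{N}$ let $W_p(\phi)=\sup\{W(\phi,x,y): x^i=y^i,\ 0\le i\le p-1\}$. A continuous $\phi$ satisfies Walters' condition if $\sup_{x,y}W(\phi,x,y)<\infty$ and $(W_p(\phi))_{p\in\mathbb{N}}$ is strictly positive and decreases to $0$. Such a $\phi$ has a unique equilibrium state $\mu_\phi$ (the unique shift-invariant probability measure maximizing $\nu\mapsto h(\nu)+\int\phi\,d\nu$, $h$ being the entropy).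 ''Admissible'' means: $\phi$ is continuous, satisfies Walters' condition, and one of: (1) $W_n(\phi)=O(\theta^n)$; (2) $W_n(\phi)=O(n^{-\alpha})$ for some $\alpha>1$; (3) $W_n(\phi)=O(\eta^{(\log n)^{\alpha}})$ for some $\eta\in(0,1)$, $\alpha>1$; (4) $W_n(\phi)=O(e^{-cn^{\alpha}})$ for some $c>0$, $\alpha\in(0,1)$. A function $K:\Omega^n\to\mathbb{R}$ is separately $d_\theta$-Lipschitz if for every $i\in\{0,\dots,n-1\}$ there is a constant $\mathrm{Lip}_{\theta,i}(K)$ (taken to be the smallest one) such that $|K(x_0,\dots,x_i,\dots,x_{n-1})-K(x_0,\dots,x_i',\dots,x_{n-1})|\le \mathrm{Lip}_{\theta,i}(K)\,d_\theta(x_i,x_i')$ for all points of $\Omega$. The Gaussian concentration bound with constant $C$: for all $n\ge1$ and all separately $d_\theta$-Lipschitz $K:\Omega^n\to\mathbb{R}$, $\int e^{K(x,\dots,T^{n-1}x)}d\mu_\phi(x)\le \exp\big(\int K(x,\dots,T^{n-1}x)\,d\mu_\phi(x)\big)\exp\big(C\sum_{j=0}^{n-1}\mathrm{Lip}_{\theta,j}(K)^2\big)$. For admissible $\phi$ such a constant $C>0$ exists (main theorem of the paper). The empirical measure is $\mathscr{E}_n(x)=\frac1n\sum_{j=0}^{n-1}\delta_{T^jx}$. For $f:\Omega\to\mathbb{R}$, $\mathrm{Lip}_\theta(f)=\sup_{x\ne y}|f(x)-f(y)|/d_\theta(x,y)$. The Kantorovich distance between Borel probability measures on $\Omega$ is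 $d_K(\nu_1,\nu_2)=\sup\{\int f\,d\nu_1-\int f\,d\nu_2:\ f:\Omega\to\mathbb{R},\ \mathrm{Lip}_\theta(f)=1\}$. *)

(* Defs.v *)
From HB Require Import structures.
From mathcomp Require Import all_boot all_order all_algebra.
From mathcomp Require Import all_classical all_reals all_analysis.

Set Implicit Arguments.
Unset Strict Implicit.
Unset Printing Implicit Defensive.

Import Order.TTheory GRing.Theory Num.Theory.
Import numFieldNormedType.Exports.

Local Open Scope classical_set_scope.
Local Open Scope ring_scope.

(* The distinguished point only witnesses that the alphabet is nonempty;
   measurable types are required to be pointed. *)
#[short(type="alphabetType")]
HB.structure Definition Alphabet := {A of Finite A & Pointed A}.

Definition Omega (A : alphabetType) : Type :=
  prod_topology (fun _ : nat => discrete_topology A).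

HB.instance Definition _ (A : alphabetType) := Pointed.on (Omega A).
HB.instance Definition _ (A : alphabetType) := Nbhs.on (Omega A).
HB.instance Definition _ (A : alphabetType) := Topological.on (Omega A).

(* Borel sigma-algebra of the product topology *)
HB.instance Definition _ (A : alphabetType) :=
  @isMeasurable.Build (sigma_display (@open (Omega A))) (Omega A)
    <<s @open (Omega A) >> (@sigma_algebra0 _ setT _)
    (@sigma_algebraC _ _) (@sigma_algebra_bigcup _ setT _).

Section Shift.
Context {A : alphabetType}.
Implicit Types x y : Omega A.

Definition shift x : Omega A := fun k => x k.+1.

(* [nth (x _) a k] is the letter of [a] at [k < size a], else the default *)
Definition prepend (a : seq A) x : Omega A :=
  fun k => nth (x (k - size a)%N) a k.

Definition orbit_seg (n : nat) x : 'I_n -> Omega A := fun j => iter j shift x.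
Arguments orbit_seg n x : clear implicits.

Definition agree (p : nat) x y : Prop := forall i, (i < p)%N -> x i = y i.

Context {R : realType}.

Definition dtheta (theta : R) x y : R :=
  match pselect (exists k, x k != y k) with
  | left h => theta ^+ ex_minn h
  | right _ => 0
  end.

Section Potential.
Implicit Types phi : Omega A -> R.

Definition birkhoff phi (n : nat) x : R := \sum_(i < n) phi (iter i shift x).

Definition Wpair phi x y : \bar R :=
  ereal_sup [set r | exists (n : nat) (a : n.-tuple A),
    r = `|birkhoff phi n (prepend a x) - birkhoff phi n (prepend a y)|%:E].

Definition Wvar phi (p : nat) : \bar R :=
  ereal_sup [set r | exists x y, agree p x y /\ r = Wpair phi x y].

Definition walters phi : Prop :=
  [/\ (ereal_sup [set Wpair phi z.1 z.2 | z in [set: Omega A * Omega A]]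
         < +oo)%E,
      forall p, (0 < Wvar phi p)%E,
      nonincreasing_seq (Wvar phi) &
      Wvar phi p @[p --> \oo] --> 0%E].

(* Under [walters] every [Wvar phi n] is finite, so [fine] loses nothing. *)
Definition Wrate phi (e : nat -> R) : Prop :=
  (fun n => fine (Wvar phi n) : R^o) =O_\oo (e : nat -> R^o).

Definition admissible (theta : R) phi : Prop :=
  [/\ continuous phi, walters phi &
   [\/ Wrate phi (fun n => theta ^+ n),
       exists2 alpha : R, 1 < alpha & Wrate phi (fun n => n%:R `^ (- alpha)),
       exists eta alpha : R, [/\ 0 < eta < 1, 1 < alpha &
         Wrate phi (fun n => eta `^ (ln n%:R `^ alpha))] |
       exists c alpha : R, [/\ 0 < c, 0 < alpha < 1 &
         Wrate phi (fun n => expR (- (c * n%:R `^ alpha)))]]].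

End Potential.

Section Entropy.
Implicit Types nu : probability (Omega A) R.

Definition shift_invariant nu : Prop :=
  forall E, measurable E -> nu (shift @^-1` E) = nu E.

(* A finite measurable partition is given by its labelling function [xi]. *)
Definition measurable_partition (k : nat) (xi : Omega A -> 'I_k) : Prop :=
  forall i, measurable (xi @^-1` [set i]).

Definition join_atom (k : nat) (xi : Omega A -> 'I_k) (n : nat)
    (w : {ffun 'I_n -> 'I_k}) : set (Omega A) :=
  [set x | forall j : 'I_n, xi (iter j shift x) = w j].

(* [ln 0 = 0], so null atoms contribute 0. *)
Definition join_entropy nu (k : nat) (xi : Omega A -> 'I_k) (n : nat) : R :=
  - \sum_(w : {ffun 'I_n -> 'I_k})
      fine (nu (join_atom xi w)) * ln (fine (nu (join_atom xi w))).

(* The limit exists for invariant [nu], by subadditivity. *)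
Definition partition_entropy nu (k : nat) (xi : Omega A -> 'I_k) : R :=
  limn (fun n => join_entropy nu xi n / n%:R : R^o).

(* Kolmogorov-Sinai entropy of the shift *)
Definition entropy nu : \bar R :=
  ereal_sup [set h | exists (k : nat) (xi : Omega A -> 'I_k),
    measurable_partition xi /\ h = (partition_entropy nu xi)%:E].

Definition pressure_functional (phi : Omega A -> R) nu : \bar R :=
  (entropy nu + \int[nu]_x (phi x)%:E)%E.

Definition equilibrium_state (phi : Omega A -> R) nu : Prop :=
  shift_invariant nu /\
  forall nu', shift_invariant nu' ->
    (pressure_functional phi nu' <= pressure_functional phi nu)%E.

End Entropy.

Section Concentration.
Variable theta : R.

Definition lip_bound_at (n : nat) (K : ('I_n -> Omega A) -> R) (i : 'I_n)
    (L : R) : Prop :=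
  forall x x' : 'I_n -> Omega A, (forall j, j != i -> x j = x' j) ->
    `|K x - K x'| <= L * dtheta theta (x i) (x' i).

Definition separately_lipschitz (n : nat) (K : ('I_n -> Omega A) -> R) : Prop :=
  forall i, exists L, lip_bound_at K i L.

(* The constraint [0 <= L] only matters for a one-letter alphabet. *)
Definition lip_at (n : nat) (K : ('I_n -> Omega A) -> R) (i : 'I_n) : R :=
  inf [set L | 0 <= L /\ lip_bound_at K i L].

Definition gaussian_concentration (mu : probability (Omega A) R) (C : R) :
    Prop :=
  forall n : nat, (1 <= n)%N -> forall K : ('I_n -> Omega A) -> R,
    separately_lipschitz K ->
    (\int[mu]_x (expR (K (orbit_seg n x)))%:E <=
     expeR (\int[mu]_x (K (orbit_seg n x))%:E) *
       (expR (C * \sum_(j < n) lip_at K j ^+ 2))%:E)%E.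

Definition lip (f : Omega A -> R) : \bar R :=
  ereal_sup [set r | exists x y, x <> y /\
    r = (`|f x - f y| / dtheta theta x y)%:E].

(* Defined for all measures; a distance on probability measures. *)
Definition kantorovich (nu1 nu2 : {measure set (Omega A) -> \bar R}) :
    \bar R :=
  ereal_sup [set (\int[nu1]_x (f x)%:E - \int[nu2]_x (f x)%:E)%E |
    f in [set f : Omega A -> R | lip f = 1%E]].

End Concentration.

Definition empirical (n : nat) x : {measure set (Omega A) -> \bar R} :=
  mscale ((n%:R : R)^-1)%:nng (msum (fun j => \d_(iter j shift x)) n).

End Shift.

(* Main.v *)
(* The map K(x_0, ..., x_{n-1}) = sup_f (n^-1 sum_j f(x_j) - int f dmu), the
   supremum being over f with Lip(f) = 1, satisfies d_K(E_n(x), mu) =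
   K(x, ..., T^{n-1} x), and it is separately Lipschitz with all constants at
   most 1/n. Applying the Gaussian concentration bound to r K and Markov's
   inequality to e^{r K} bounds the upper tail by exp(- r u + C r^2 / n);
   r = n u / (2 C) is optimal, and - K gives the lower tail. *)
Require Import Defs.
From HB Require Import structures.
From mathcomp Require Import all_boot all_order all_algebra.
From mathcomp Require Import all_classical all_reals all_analysis.
From mathcomp Require Import measurable_realfun ring.
Import Order.TTheory GRing.Theory Num.Theory.
Import numFieldNormedType.Exports.
Set Implicit Arguments.
Unset Strict Implicit.

Local Open Scope classical_set_scope.
Local Open Scope ring_scope.

(** * The distance [dtheta] and agreement of initial words *)

Lemma dtheta_ge0 {R : realType} {A : alphabetType} (theta : R) (x y : Omega A) :
  0 < theta -> 0 <= dtheta theta x y.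
Proof. by move=> t0; rewrite /dtheta; case: pselect => // h; rewrite exprn_ge0 ?ltW. Qed.

Lemma dtheta_le1 {R : realType} {A : alphabetType} (theta : R) (x y : Omega A) :
  0 < theta < 1 -> dtheta theta x y <= 1.
Proof.
move=> /andP[t0 t1]; rewrite /dtheta; case: pselect => // h.
by rewrite exprn_ile1 // ltW.
Qed.

Lemma dthetaxx {R : realType} {A : alphabetType} (theta : R) (x : Omega A) :
  dtheta theta x x = 0.
Proof. by rewrite /dtheta; case: pselect => // h; exfalso; case: h => k /eqP. Qed.

Lemma dtheta_gt0 {R : realType} {A : alphabetType} (theta : R) (x y : Omega A) :
  0 < theta -> x <> y -> 0 < dtheta theta x y.
Proof.
move=> t0 xy; rewrite /dtheta; case: pselect => [h|h]; first by rewrite exprn_gt0.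
case: xy; apply/funext => k; apply/eqP/negPn/negP => xk; apply: h.
by exists k.
Qed.

Lemma dthetaC {R : realType} {A : alphabetType} (theta : R) (x y : Omega A) :
  dtheta theta x y = dtheta theta y x.
Proof.
rewrite /dtheta; case: pselect => [h|h]; case: pselect => [h'|h'] //.
- by congr (_ ^+ _); apply: eq_ex_minn => k; rewrite eq_sym.
- by exfalso; apply: h'; case: h => k; exists k; rewrite eq_sym.
- by exfalso; apply: h; case: h' => k; exists k; rewrite eq_sym.
Qed.

Lemma dtheta_agree {R : realType} {A : alphabetType} (theta : R) (p : nat)
    (x y : Omega A) :
  0 < theta < 1 -> agree p x y -> dtheta theta x y <= theta ^+ p.
Proof.
move=> /andP[t0 t1] xy; rewrite /dtheta; case: pselect => [h|_]; last first.
  by rewrite exprn_ge0 // ltW.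
case: ex_minnP => m xym _; rewrite ler_wiXn2l ?ltW // leqNgt.
by apply/negP => /xy xyE; rewrite xyE eqxx in xym.
Qed.

Lemma dtheta_eq1 {R : realType} {A : alphabetType} (theta : R) (x y : Omega A) :
  x 0%N <> y 0%N -> dtheta theta x y = 1.
Proof.
move=> xy; rewrite /dtheta; case: pselect => [h|h]; last first.
  by case: h; exists 0%N; apply/eqP.
case: ex_minnP => m _ /(_ 0%N); move/eqP in xy.
by move=> /(_ xy); rewrite leqn0 => /eqP->.
Qed.

Lemma agree_iter_shift {A : alphabetType} (p n j : nat) (x y : Omega A) :
  (j <= n)%N -> agree (p + n) x y ->
  agree p (iter j Defs.shift x) (iter j Defs.shift y).
Proof.
have iterE (z : Omega A) k i : iter k Defs.shift z i = z (i + k)%N.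
  elim: k i => [|k IH] i; first by rewrite addn0.
  by rewrite iterS /Defs.shift IH addSnnS.
move=> jn xy i ip; rewrite !iterE; apply: xy.
by rewrite -addSn leq_add.
Qed.

(** * Cylinders and Borel measurability *)

Lemma nbhs_agree {A : alphabetType} (p : nat) (x : Omega A) :
  nbhs x [set y | agree p x y].
Proof.
elim: p => [|p IH]; first by apply: filterS filterT => y _ i.
have xp : nbhs x [set y : Omega A | x p = y p].
  (* [K] exhibits [Omega A] as the product it unfolds to, so that continuity of the coordinate
     projections applies. *)
  pose K (_ : nat) : topologicalType := discrete_topology A.
  apply: (@proj_continuous nat K p x [set a | x p = a]).
  have : nbhs (x p : discrete_topology A) [set x p] by exact: discrete_set1.
  suff -> : [set a | x p = a] = [set x p] by [].
  by apply/seteqP; split=> a /= ->.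
apply: filterS2 IH xp => y /= xy xyp i; rewrite ltnS leq_eqVlt => /orP[/eqP->//|].
exact: xy.
Qed.

(** The preimage of an open interval contains a cylinder around each of its points, hence is open.
    Stating continuity through cylinders avoids showing that [dtheta] induces the topology. *)
Lemma cylinder_continuous_measurable {R : realType} {A : alphabetType}
    (g : Omega A -> R) :
  (forall e : R, 0 < e -> exists p, forall x y, agree p x y -> `|g x - g y| <= e) ->
  measurable_fun setT g.
Proof.
move=> gcont; apply: (measurability _ (RGenOpens.measurableE R)).
move=> _ [_ [a [b ->]] <-]; rewrite setTI; apply: sub_sigma_algebra.
rewrite /= openE => x /=; rewrite in_itv /= => /andP[ag gb].
(* Half the distance to the nearer endpoint turns the bound [<= e] into a strict one. *)
pose e := Num.min (g x - a) (b - g x) / 2.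
have m0 : 0 < Num.min (g x - a) (b - g x) by rewrite lt_min !subr_gt0 ag.
have e0 : 0 < e by rewrite divr_gt0.
have [p pe] := gcont e e0.
apply: filterS (nbhs_agree p x) => y /= /pe gxy.
have {}gxy : `|g x - g y| < Num.min (g x - a) (b - g x).
  by rewrite (le_lt_trans gxy) // /e ltr_pdivrMr // ltr_pMr // ltr1n.
move: gxy; rewrite lt_min !ltr_norml in_itv /= => /andP[/andP[_ h1] /andP[h2 _]].
apply/andP; split.
  by move: h1; rewrite ltrD2l ltrN2.
by move: h2; rewrite opprB ltrD2l ltrN2.
Qed.

Lemma lip1_le {R : realType} {A : alphabetType} (theta : R) (f : Omega A -> R)
    (x y : Omega A) :
  0 < theta -> lip theta f = 1%E -> `|f x - f y| <= dtheta theta x y.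
Proof.
move=> t0 f1; have [->|/eqP xy] := eqVneq x y; first by rewrite subrr normr0 dthetaxx.
have d0 := dtheta_gt0 t0 xy.
rewrite -(mul1r (dtheta _ _ _)) -ler_pdivrMr // -lee_fin -[leRHS]f1.
by apply: ereal_sup_ubound; exists x, y.
Qed.

Lemma lip1_measurable {R : realType} {A : alphabetType} (theta : R)
    (f : Omega A -> R) :
  0 < theta < 1 -> lip theta f = 1%E -> measurable_fun setT f.
Proof.
move=> t01 f1; have /andP[t0 t1] := t01.
apply: cylinder_continuous_measurable => e e0.
have /cvgrPdist_le/(_ _ e0)[p _ pe] : theta ^+ n @[n --> \oo] --> 0.
  by apply: cvg_expr; rewrite ger0_norm // ltW.
exists p => x y xy; rewrite (le_trans (lip1_le x y t0 f1)) //.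
rewrite (le_trans (dtheta_agree t01 xy)) //.
by have := pe p (leqnn p); rewrite /= sub0r normrN ger0_norm // exprn_ge0 // ltW.
Qed.

(** * Separately Lipschitz functions along orbits *)

(** The coordinates are exchanged one at a time, and the increments are added by the triangle
    inequality. *)
Lemma lip_bound_at_sum {R : realType} {A : alphabetType} (theta : R) (n : nat)
    (K : ('I_n -> Omega A) -> R) (L : 'I_n -> R) (X Y : 'I_n -> Omega A) :
  (forall i, lip_bound_at theta K i (L i)) ->
  `|K X - K Y| <= \sum_(i < n) L i * dtheta theta (X i) (Y i).
Proof.
(* [Z k] takes its first [k] coordinates from [Y] and the others from [X], so [Z k] and [Z k.+1]
   differ at most at index [k]. *)
move=> KL; pose Z k := fun i : 'I_n => if (i < k)%N then Y i else X i.
have Z0 : Z 0%N = X by apply/funext => i; rewrite /Z.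
have Zn : Z n = Y by apply/funext => i; rewrite /Z ltn_ord.
suff H k : (k <= n)%N ->
    `|K X - K (Z k)| <= \sum_(i < n | (i < k)%N) L i * dtheta theta (X i) (Y i).
  rewrite -{1}Zn (le_trans (H n (leqnn n))) //.
  by rewrite (eq_bigl xpredT) // => i; rewrite ltn_ord.
elim: k => [_|k IH kn]; first by rewrite Z0 subrr normr0 big_pred0.
pose o := Ordinal kn.
rewrite (bigD1 o) /=; last by rewrite ltnSn.
have -> : K X - K (Z k.+1) = (K (Z k) - K (Z k.+1)) + (K X - K (Z k)).
  by rewrite [RHS]addrC addrA subrK.
rewrite (le_trans (ler_normD _ _)) // lerD //.
  have <- : Z k o = X o by rewrite /Z /= ltnn.
  have <- : Z k.+1 o = Y o by rewrite /Z /= ltnSn.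
  apply: KL.
  move=> j jo; rewrite /Z [in RHS]ltnS [in RHS]leq_eqVlt.
  by rewrite (_ : (nat_of_ord j == k) = false) //; apply: negbTE.
rewrite (le_trans (IH (ltnW kn))) // le_eqVlt; apply/orP; left; apply/eqP.
apply: eq_bigl => i; rewrite ltnS [in RHS]leq_eqVlt.
have [->|io] := eqVneq i o; first by rewrite ltnn andbF.
by rewrite (_ : (nat_of_ord i == k) = false) ?andbT //; apply: negbTE.
Qed.

(** Two points with a long common initial word have orbit segments that are close in every
    coordinate, so the Lipschitz bounds alone give measurability. *)
Lemma lip_bound_at_orbit_measurable {R : realType} {A : alphabetType} (theta : R)
    (n : nat) (K : ('I_n -> Omega A) -> R) (L : 'I_n -> R) :
  0 < theta < 1 -> (forall i, 0 <= L i) ->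
  (forall i, lip_bound_at theta K i (L i)) ->
  measurable_fun setT (fun x => K (orbit_seg x)).
Proof.
move=> t01 L0 KL; have /andP[t0 t1] := t01.
apply: cylinder_continuous_measurable => e e0.
have /cvgrPdist_le/(_ _ e0)[p _ pe] :
    (\sum_(i < n) L i) * theta ^+ p @[p --> \oo] --> (\sum_(i < n) L i) * 0.
  by apply: cvgM; [exact: cvg_cst|apply: cvg_expr; rewrite ger0_norm // ltW].
(* The extra [n] letters absorb the shifts: corresponding points of the two orbit segments still
   agree on [p] letters. *)
exists (p + n)%N => x y xy.
apply: (le_trans (lip_bound_at_sum _ _ KL)).
apply: (@le_trans _ _ ((\sum_(i < n) L i) * theta ^+ p)).
  rewrite mulr_suml; apply: ler_sum => i _; rewrite ler_wpM2l //.
  by apply: dtheta_agree => //; apply: agree_iter_shift xy; rewrite ltnW.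
have := pe p (leqnn p); rewrite /= mulr0 sub0r normrN ger0_norm //.
by rewrite mulr_ge0 ?sumr_ge0 // exprn_ge0 // ltW.
Qed.

(** Bounded oscillation bounds [f] itself, by comparison with its value at [point]. *)
Lemma bounded_diff_integrable {d} {T : measurableType d} {R : realType}
    (mu : probability T R) (f : T -> R) (M : R) :
  measurable_fun setT f -> (forall x y, `|f x - f y| <= M) ->
  mu.-integrable setT (EFin \o f).
Proof.
move=> mf fM; have mu_fin : (mu setT < +oo)%E by rewrite probability_setT ltry.
apply: measurable_bounded_integrable => //.
exists (`|f point| + M); split; first exact: num_real.
move=> r Mr x _; rewrite /= (le_trans _ (ltW Mr)) //.
by rewrite -(subrK (f point) (f x)) addrC (le_trans (ler_normD _ _)) // lerD2l.
Qed.

Lemma lip_bound_at_orbit_integrable {R : realType} {A : alphabetType} (theta : R)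
    (mu : probability (Omega A) R)
    (n : nat) (K : ('I_n -> Omega A) -> R) (L : 'I_n -> R) :
  0 < theta < 1 -> (forall i, 0 <= L i) ->
  (forall i, lip_bound_at theta K i (L i)) ->
  mu.-integrable setT (fun x => (K (orbit_seg x))%:E).
Proof.
move=> t01 L0 KL.
apply: (@bounded_diff_integrable _ _ _ mu _ (\sum_(i < n) L i)) => [|x y].
  exact: lip_bound_at_orbit_measurable KL.
rewrite (le_trans (lip_bound_at_sum _ _ KL)) // ler_sum // => i _.
by rewrite ler_piMr // dtheta_le1.
Qed.

Lemma lip_bound_atZ {R : realType} {A : alphabetType} (theta : R) (n : nat)
    (K : ('I_n -> Omega A) -> R) (i : 'I_n) (L r : R) :
  lip_bound_at theta K i L -> lip_bound_at theta (fun X => r * K X) i (`|r| * L).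
Proof.
by move=> KL X Y XY; rewrite -mulrBr normrM -mulrA ler_wpM2l // KL.
Qed.

(** [L] belongs to the set whose infimum is [lip_at], and 0 is a lower bound of that set. The lower
    estimate allows the upper one to be squared. *)
Lemma lip_at_le {R : realType} {A : alphabetType} (theta : R) (n : nat)
    (K : ('I_n -> Omega A) -> R) (i : 'I_n) (L : R) :
  0 <= L -> lip_bound_at theta K i L -> 0 <= lip_at theta K i <= L.
Proof.
move=> L0 KL; apply/andP; split.
  by apply: lb_le_inf; [exists L|move=> x []].
by apply: ge_inf; [exists 0 => x []|].
Qed.

(** * Tail bounds from Gaussian concentration *)

(** The exponential Markov argument works for arbitrary bounds [L]: the sum of their squares
    controls the variance term. *)
Lemma gaussian_concentration_upper_tail {R : realType} {A : alphabetType}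
    (theta : R) (mu : probability (Omega A) R) (C : R) (n : nat)
    (K : ('I_n -> Omega A) -> R) (L : 'I_n -> R) (u : R) :
  0 < theta < 1 -> 0 < C -> gaussian_concentration theta mu C -> (0 < n)%N ->
  (forall i, 0 <= L i) -> (forall i, lip_bound_at theta K i (L i)) ->
  0 < \sum_(i < n) L i ^+ 2 -> 0 < u ->
  (mu [set x | (u <= K (orbit_seg x) - \int[mu]_y K (orbit_seg y))%R]
   <= (expR (- (u ^+ 2 / (4 * C * \sum_(i < n) L i ^+ 2))))%:E)%E.
Proof.
move=> t01 C0 gcb n0 L0 KL; set s := \sum_(i < n) _ => s0 u0.
set g := fun x => K (orbit_seg x).
have mg : measurable_fun setT g by exact: lip_bound_at_orbit_measurable KL.
have ig : mu.-integrable setT (EFin \o g) by exact: lip_bound_at_orbit_integrable KL.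
set m := Rintegral _ _ _.
have mE : (\int[mu]_y (g y)%:E = m%:E)%E.
  by rewrite /m /Rintegral fineK // integrable_fin_num.
(* This [r] minimizes [C * s * r ^+ 2 - r * u], with minimum [- (u ^+ 2 / (4 * C * s))]. *)
pose r := u / (2 * C * s).
have r0 : 0 < r by rewrite divr_gt0 // !mulr_gt0.
pose X : {RV mu >-> R} := mfun_Sub (mem_set mg).
have XE x : X x = g x by [].
(* The mean moves into the threshold; the factor [expR (r * m)] from the concentration bound later
   cancels it. *)
have -> : [set x | u <= g x - m] = [set x | m + u <= X x].
  by apply/seteqP; split=> x /=; rewrite lerBrDl.
apply: (le_trans (chernoff X (m + u) r0)).
have rKL i : lip_bound_at theta (fun Y => r * K Y) i (r * L i).
  by rewrite -{2}(ger0_norm (ltW r0)); exact: lip_bound_atZ.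
have sepK : separately_lipschitz theta (fun Y => r * K Y).
  by move=> i; exists (r * L i).
have := gcb n n0 _ sepK.
have -> : (\int[mu]_x (r * K (orbit_seg x))%:E = (r * m)%:E)%E.
  under eq_integral do rewrite EFinM.
  by rewrite (EFinM r m) -mE; exact: integralZl.
move=> /= gcbr.
have -> : ('M_mu X r = \int[mu]_x (expR (r * K (orbit_seg x)))%:E)%E.
  rewrite /mmt_gen_fun unlock; apply: eq_integral => x _ /=.
  by rewrite mulrC.
apply: (le_trans (lee_wpmul2r _ gcbr)); first by rewrite lee_fin expR_ge0.
rewrite -!EFinM lee_fin -!expRD ler_expR.
(* The concentration bound involves the smallest constants of [r * K], of which only the upper
   bounds [r * L j] are known. *)
have lips : \sum_(j < n) lip_at theta (fun Y => r * K Y) j ^+ 2 <= r ^+ 2 * s.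
  rewrite mulr_sumr; apply: ler_sum => j _; rewrite -exprMn.
  have /andP[l0 l1] := lip_at_le (mulr_ge0 (ltW r0) (L0 j)) (rKL j).
  by rewrite ler_sqr // nnegrE // mulr_ge0 // ltW.
have {}lips := ler_wpM2l (ltW C0) lips.
suff E : r * m + C * (r ^+ 2 * s) - r * (m + u) = - (u ^+ 2 / (4 * C * s)).
  by rewrite -E lerD2r lerD2l.
by rewrite /r; field; rewrite !lt0r_neq0.
Qed.

(** [K] and [-1 * K] have the same Lipschitz bounds; the union bound over the two tails produces the
    factor 2. *)
Lemma gaussian_concentration_tail {R : realType} {A : alphabetType}
    (theta : R) (mu : probability (Omega A) R) (C : R) (n : nat)
    (K : ('I_n -> Omega A) -> R) (L : 'I_n -> R) (u : R) :
  0 < theta < 1 -> 0 < C -> gaussian_concentration theta mu C -> (0 < n)%N ->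
  (forall i, 0 <= L i) -> (forall i, lip_bound_at theta K i (L i)) ->
  0 < \sum_(i < n) L i ^+ 2 -> 0 < u ->
  (mu [set x |
     (u <= `|K (orbit_seg x) - \int[mu]_y K (orbit_seg y)|)%R]
   <= (2 * expR (- (u ^+ 2 / (4 * C * \sum_(i < n) L i ^+ 2))))%:E)%E.
Proof.
move=> t01 C0 gcb n0 L0 KL s0 u0.
have mK : measurable_fun setT (fun x => K (orbit_seg x)).
  exact: lip_bound_at_orbit_measurable KL.
have iK : mu.-integrable setT (fun x => (K (orbit_seg x))%:E).
  exact: lip_bound_at_orbit_integrable KL.
have NKL i : lip_bound_at theta (fun X => -1 * K X) i (L i).
  by have := lip_bound_atZ (-1) (KL i); rewrite normrN1 mul1r.
have up := gaussian_concentration_upper_tail t01 C0 gcb n0 L0 KL s0 u0.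
have lo := gaussian_concentration_upper_tail t01 C0 gcb n0 L0 NKL s0 u0.
set m := Rintegral _ _ _ in up *.
have mN : \int[mu]_y (-1 * K (orbit_seg y)) = - m.
  by rewrite RintegralZl // mulN1r.
rewrite {}mN in lo.
(* Both tails have this form: [a = 1], [b = m] for the upper one and [a = -1], [b = - m] for the
   lower one. *)
have mS a b : measurable [set x | u <= a * K (orbit_seg x) - b].
  rewrite -[X in measurable X]setTI.
  rewrite (_ : [set x | _] = (fun x => a * K (orbit_seg x) - b) @^-1` `[u, +oo[).
    by apply: measurable_funB => //; exact: measurable_funM.
  by apply/seteqP; split=> x /=; rewrite in_itv /= andbT.
set e := expR _ in up lo *.
have -> : (2 * e)%:E = (e%:E + e%:E)%E by rewrite -EFinD mulr_natl mulr2n.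
apply: le_trans (leeD up lo).
have -> : [set x | u <= `|K (orbit_seg x) - m|] =
    [set x | u <= 1 * K (orbit_seg x) - m] `|` [set x | u <= -1 * K (orbit_seg x) - - m].
  by apply/seteqP; split=> x /=; rewrite mul1r mulN1r -opprD ler_normr => /orP.
apply: le_trans (measureU2 _ (mS _ _) (mS _ _)) _.
by under [in leLHS]eq_set do rewrite mul1r.
Qed.

(** * Empirical measures and the Kantorovich distance *)

(** For nonnegative functions the integral is additive in the measure, which reduces it to Dirac
    masses. The general case subtracts the negative part from the positive part, both integrals
    being finite sums. *)
Lemma integral_empirical {R : realType} {A : alphabetType} (n : nat)
    (x : Omega A) (f : Omega A -> R) :
  measurable_fun setT f ->
  (\int[empirical n x]_y (f y)%:E =
   (n%:R^-1 * \sum_(i < n) f (orbit_seg x i))%:E)%E.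
Proof.
move=> mf.
have ge0E (h : Omega A -> R) : measurable_fun setT h -> (forall y, 0 <= h y) ->
    (\int[empirical n x]_y (h y)%:E =
     (n%:R^-1 * \sum_(i < n) h (orbit_seg x i))%:E)%E.
  move=> mh h0; have mEh : measurable_fun setT (EFin \o h) by exact/measurable_EFinP.
  have Eh0 y : setT y -> (0 <= (h y)%:E)%E by rewrite lee_fin.
  rewrite /empirical ge0_integral_mscale // ge0_integral_measure_sum //.
  rewrite EFinM -sumEFin; congr (_ * _)%E.
  by apply: eq_bigr => i _; rewrite integral_dirac // diracT mul1e.
rewrite integralE funerpos funerneg !ge0E //; last 2 first.
- exact: measurable_funrneg.
- exact: measurable_funrpos.
rewrite -EFinB -mulrBr -sumrB; congr (_ * _)%:E.
by apply: eq_bigr => i _; rewrite -[in RHS](funrposBneg f).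
Qed.

Lemma lip1_dist_le1 {R : realType} {A : alphabetType} (theta : R)
    (f : Omega A -> R) (x y : Omega A) :
  0 < theta < 1 -> lip theta f = 1%E -> `|f x - f y| <= 1.
Proof.
move=> t01 f1; have /andP[t0 _] := t01.
by rewrite (le_trans (lip1_le x y t0 f1)) // dtheta_le1.
Qed.

Lemma lip1_integrable {R : realType} {A : alphabetType} (theta : R)
    (mu : probability (Omega A) R) (f : Omega A -> R) :
  0 < theta < 1 -> lip theta f = 1%E -> mu.-integrable setT (EFin \o f).
Proof.
move=> t01 f1; apply: (@bounded_diff_integrable _ _ _ mu f 1).
  exact: lip1_measurable f1.
by move=> x y; exact: lip1_dist_le1 f1.
Qed.

(** The pointwise inequality [f x - 1 <= f y] is integrated in [y] against a probability. *)
Lemma lip1_sub_Rintegral_le1 {R : realType} {A : alphabetType} (theta : R)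
    (mu : probability (Omega A) R) (f : Omega A -> R) (x : Omega A) :
  0 < theta < 1 -> lip theta f = 1%E -> f x - \int[mu]_y f y <= 1.
Proof.
move=> t01 f1; have intf := lip1_integrable mu t01 f1.
have mu1 : fine (mu setT) = 1 by rewrite probability_setT.
have intc (r : R) : mu.-integrable setT (EFin \o cst r).
  by apply: (@bounded_diff_integrable _ _ _ mu _ 0) => // y z; rewrite subrr normr0.
rewrite lerBlDl -lerBlDr.
have := Rintegral_cst mu measurableT (f x - 1); rewrite mu1 mulr1 => <-.
apply: le_Rintegral => //; [exact: intc|move=> y _; rewrite lerBlDr -lerBlDl].
exact: le_trans (ler_norm _) (lip1_dist_le1 _ _ t01 f1).
Qed.

(** At [X = orbit_seg x] the supremum of this set is the Kantorovich distance from the empirical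
    measure to [mu]. Allowing arbitrary tuples [X] yields a function of [n] independent variables,
    as the concentration bound requires. *)
Definition lip1_deviations {R : realType} {A : alphabetType} (theta : R)
    (mu : probability (Omega A) R) {n : nat} (X : 'I_n -> Omega A) : set R :=
  [set n%:R^-1 * (\sum_(i < n) f (X i)) - \int[mu]_y f y |
     f in [set f : Omega A -> R | lip theta f = 1%E]].

Lemma lip1_deviations_has_ubound {R : realType} {A : alphabetType} (theta : R)
    (mu : probability (Omega A) R) {n : nat} (X : 'I_n -> Omega A) :
  0 < theta < 1 -> (0 < n)%N -> has_ubound (lip1_deviations theta mu X).
Proof.
move=> t01 n0; exists 1 => _ [f /= f1 <-].
rewrite lerBlDr -ler_pdivlMl ?invr_gt0 ?ltr0n // invrK mulr_natl.
(* The multiple by [n] becomes a constant sum over ['I_n], so the comparison is termwise. *)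
rewrite -[X in _ *+ X]card_ord -sumr_const; apply: ler_sum => i _.
by rewrite -lerBlDr (@lip1_sub_Rintegral_le1 _ _ theta).
Qed.

(** Moving one point changes one term of each average, hence each deviation by at most [dtheta / n];
    the bound is uniform in [f] and so passes to the supremum. An [f] with [lip theta f = 1] makes
    the set nonempty, as [ge_sup] demands. *)
Lemma sup_lip1_deviations_lip_bound {R : realType} {A : alphabetType} (theta : R)
    (mu : probability (Omega A) R) (n : nat) (i : 'I_n) :
  0 < theta < 1 -> (0 < n)%N -> (exists f : Omega A -> R, lip theta f = 1%E) ->
  lip_bound_at theta (fun X : 'I_n -> Omega A => sup (lip1_deviations theta mu X))
    i n%:R^-1.
Proof.
move=> t01 n0 [f0 f01]; have /andP[t0 t1] := t01.
(* The one-sided estimate suffices: exchanging [X] and [Y] gives the other side. *)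
have H (X Y : 'I_n -> Omega A) : (forall j, j != i -> X j = Y j) ->
    sup (lip1_deviations theta mu X) - sup (lip1_deviations theta mu Y)
      <= n%:R^-1 * dtheta theta (X i) (Y i).
  move=> XY; rewrite lerBlDr; apply: ge_sup; first by eexists; exists f0.
  move=> _ [f /= f1 <-].
  have : n%:R^-1 * (\sum_(j < n) f (Y j)) - \int[mu]_y f y <=
      sup (lip1_deviations theta mu Y).
    by apply: ub_le_sup; [exact: lip1_deviations_has_ubound|exists f].
  rewrite -(lerD2l (n%:R^-1 * dtheta theta (X i) (Y i))); apply: le_trans.
  rewrite addrA lerD2r -mulrDr ler_wpM2l //.
  rewrite (bigD1 i) //= [in leRHS](bigD1 i) //= addrA; apply: lerD.
    rewrite -lerBlDr; apply: le_trans (ler_norm _) _; exact: lip1_le.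
  by rewrite le_eqVlt; apply/orP; left; apply/eqP; apply: eq_bigr => j /XY ->.
move=> X Y XY; rewrite ler_norml H // andbT.
rewrite lerNl opprB.
have -> : dtheta theta (X i) (Y i) = dtheta theta (Y i) (X i) by exact: dthetaC.
by apply: H => j /XY.
Qed.

(** Every difference of integrals is a real number, and the set of these is nonempty and bounded
    above, so the extended supremum is the real one. *)
Lemma kantorovich_empirical {R : realType} {A : alphabetType} (theta : R)
    (mu : probability (Omega A) R) (n : nat) (x : Omega A) :
  0 < theta < 1 -> (0 < n)%N -> (exists f : Omega A -> R, lip theta f = 1%E) ->
  kantorovich theta (empirical n x) mu =
  (sup (lip1_deviations theta mu (orbit_seg (n := n) x)))%:E.
Proof.
move=> t01 n0 [f0 f01]; rewrite -ereal_sup_EFin; last 2 first.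
- exact: lip1_deviations_has_ubound.
- by eexists; exists f0.
have devE f : lip theta f = 1%E ->
    (\int[empirical n x]_y (f y)%:E - \int[mu]_y (f y)%:E =
     (n%:R^-1 * (\sum_(i < n) f (orbit_seg x i)) - \int[mu]_y f y)%:E)%E.
  move=> f1; rewrite integral_empirical; last exact: lip1_measurable f1.
  rewrite EFinB /Rintegral fineK // integrable_fin_num //.
  exact: lip1_integrable f1.
rewrite /kantorovich /lip1_deviations image_comp; congr (ereal_sup _).
by apply: eq_imagel => f f1; exact: devE.
Qed.

(* On a one-letter alphabet no f has Lip(f) = 1 and the Kantorovich distance
   is the supremum of the empty set, -oo; strict positivity of W_p excludes it. *)
Lemma walters_alphabet_nontrivial {R : realType} {A : alphabetType}
    (phi : Omega A -> R) : walters phi -> exists a b : A, a <> b.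
Proof.
case=> _ /(_ 0%N) W0 _ _.
apply: contrapT => noab; move: W0; apply/negP; rewrite -leNgt.
apply: ge_ereal_sup => _ [x [y [_ ->]]]; apply: ge_ereal_sup => _ [m [a ->]].
(* Without two distinct letters all sequences coincide, so every term of [Wpair] vanishes. *)
suff -> : x = y by rewrite subrr normr0.
apply/funext => k; apply: contrapT => xyk; apply: noab.
by exists (x k), (y k).
Qed.

(** The witness is the indicator of the first letter being [a]. Only points with different first
    letters are separated, and these are at distance 1; the constant sequences [a] and [b] attain
    the ratio 1. *)
Lemma lip1_nonempty {R : realType} {A : alphabetType} (theta : R) (a b : A) :
  0 < theta -> a <> b -> exists f : Omega A -> R, lip theta f = 1%E.
Proof.
move=> t0 ab; exists (fun x => (x 0%N == a)%:R); apply/eqP; rewrite eq_le.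
apply/andP; split.
  apply: ge_ereal_sup => _ [x [y [xy ->]]]; rewrite lee_fin.
  rewrite ler_pdivrMr ?mul1r ?dtheta_gt0 //.
  have [xy0|/eqP xy0] := eqVneq (x 0%N) (y 0%N).
    by rewrite xy0 subrr normr0 dtheta_ge0.
  rewrite dtheta_eq1 //; do 2!case: eqP => _;
  by rewrite ?subrr ?normr0 ?sub0r ?normrN ?subr0 ?normr1.
apply: ereal_sup_ubound; exists (fun=> a), (fun=> b); split.
  by move/(congr1 (fun z : Omega A => z 0%N)).
rewrite dtheta_eq1 // eqxx (_ : (b == a) = false) ?subr0 ?normr1 ?divr1 //.
by apply/eqP => /esym.
Qed.

Theorem theorem3p8 (R : realType) (A : alphabetType) (theta : R)
    (phi : Omega A -> R) (mu : probability (Omega A) R) (C : R)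
    (theta_gt0 : 0 < theta) (theta_lt1 : theta < 1)
    (phi_adm : admissible theta phi)
    (mu_eq : equilibrium_state phi mu)
    (C_gt0 : 0 < C)
    (gcb : gaussian_concentration theta mu C)
    (u : R) (n : nat) (u_gt0 : 0 < u) (n_ge1 : (1 <= n)%N) :
  (mu [set x | u%:E <= `| kantorovich theta (empirical n x) mu
                 - \int[mu]_y kantorovich theta (empirical n y) mu |]
   <= (2 * expR (- ((4 * C)^-1 * n%:R * u ^+ 2)))%R%:E)%E.
Proof.
have t01 : 0 < theta < 1 by rewrite theta_gt0.
have [_ W _] := phi_adm.
have [a [b ab]] := walters_alphabet_nontrivial W.
have lip1_ex := lip1_nonempty theta_gt0 ab.
pose K (X : 'I_n -> Omega A) := sup (lip1_deviations theta mu X).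
have nV0 : 0 < n%:R^-1 :> R by rewrite invr_gt0 ltr0n.
have KL i : lip_bound_at theta K i n%:R^-1.
  exact: sup_lip1_deviations_lip_bound.
have kE x : kantorovich theta (empirical n x) mu = (K (orbit_seg x))%:E.
  exact: kantorovich_empirical.
have intK : mu.-integrable setT (fun x => (K (orbit_seg x))%:E).
  by apply: (lip_bound_at_orbit_integrable _ t01 _ KL) => i; exact: ltW.
(* The [n] squares [n ^- 2] add up to [n^-1], which puts the factor [n] into the exponent. *)
have sE : \sum_(i < n) (n%:R^-1 : R) ^+ 2 = n%:R^-1.
  rewrite sumr_const card_ord -[LHS]mulr_natr expr2 -mulrA mulVf ?mulr1 //.
  by rewrite pnatr_eq0 -lt0n.
have := gaussian_concentration_tail t01 C_gt0 gcb n_ge1 (fun=> ltW nV0) KL.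
rewrite sE => /(_ u nV0 u_gt0).
have -> : u ^+ 2 / (4 * C * n%:R^-1) = (4 * C)^-1 * n%:R * u ^+ 2.
  by field; rewrite gt_eqF //= pnatr_eq0 -lt0n.
have intE : (\int[mu]_y kantorovich theta (empirical n y) mu =
    (\int[mu]_y K (orbit_seg y))%:E)%E.
  rewrite (eq_integral (fun y => (K (orbit_seg y))%:E)) //.
  by rewrite /Rintegral fineK // integrable_fin_num.
(* Since the distance and its mean are real, the event in extended reals is the real one already
   bounded. *)
by congr (mu _ <= _)%E; apply/seteqP; split=> x /=; rewrite kE intE.
Qed.
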